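(* Let $G=\mathbb{Z}_{p^e}\times\mathbb{Z}_{p^t}$, where $p$ is a prime and $e,t\ge1$, and let $A$ be the adjacency matrix of $\Gamma(G)$. Then the spectrum of $A$ is $$\mathrm{Spec}(A)=\begin{pmatrix}-\alpha&0&p\alpha\\ p&p^{e+t}-(p+1)&1\end{pmatrix},$$ where $\alpha=\varphi(p^{e+t-1})$.
   Context: The generating graph $\Gamma(G)$ of a group $G$ is the simple graph with vertex set $G$ in which two distinct vertices $x,y$ are adjacent if and only if $\langle x,y\rangle=G$. $\varphi$ is the Euler totient function. In the array for $\mathrm{Spec}$, the first row lists the eigenvalues and the second row their respective multiplicities. *)

(* Defs.v *)
From HB Require Import structures.
From mathcomp Require Import all_boot all_order all_algebra all_fingroup.

Set Implicit Arguments.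
Unset Strict Implicit.
Unset Printing Implicit Defensive.

Import GRing.Theory.
Local Open Scope ring_scope.

Definition generating_graph (gT : finGroupType) : rel gT :=
  fun x y => (x != y) && (<<[set x; y]>>%g == [set: gT]).

(* The vertices are ordered by their position in [enum T]; the spectrum does
   not depend on this choice. *)
Definition adjacency_mx (F : fieldType) (T : finType) (adj : rel T) :
    'M[F]_#|T| :=
  \matrix_(i, j) (adj (enum_val i) (enum_val j))%:R.

(* [spectrum_is A s]: the pairs of [s] are the columns of the array Spec(A),
   i.e. the distinct eigenvalues of [A] in [F], each paired with its algebraic
   multiplicity (its order as a root of the characteristic polynomial). *)
Definition spectrum_is (F : fieldType) (n : nat) (A : 'M[F]_n)
    (s : seq (F * nat)) : Prop :=
  [/\ uniq (unzip1 s),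
      forall a : F, eigenvalue A a = (a \in unzip1 s)
    & forall c : F * nat, c \in s -> mup c.1 (char_poly A) = c.2].

(* Main.v *)
Require Import Defs.
From HB Require Import structures.
From mathcomp Require Import all_boot all_order all_algebra all_fingroup.
From mathcomp Require Import zify.

(* Let F_p^2 be the reduction of G modulo p. Two elements generate G iff their
   images are linearly independent, that is, nonzero and on different lines.
   Since each of the p + 1 lines has alpha nonzero preimages, the generating
   graph is complete multipartite with p + 1 parts of size alpha, plus isolated
   vertices. If B is the vertex-part incidence matrix and J the all-ones matrix,
   then A = B (J - 1) B^T and B^T B = alpha, so that det (y - u v) and
   det (y - v u), which agree up to powers of y, reduce the characteristic
   polynomial of A to that of alpha (J - 1), of size p + 1. *)

Set Implicit Arguments.
Unset Strict Implicit.
Unset Printing Implicit Defensive.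

Import GRing.Theory Num.Theory.
Local Open Scope ring_scope.

(** * Determinants of low-rank perturbations of scalar matrices *)

(** Both sides equal [y ^+ n * \det M] for the block matrix [M] with rows [(y, u)] and [(v, 1)]:
    column operations clear [v] at no cost, row operations clear it at the cost of [y ^+ n]. *)
Lemma det_scalar_sub_mulmxC (R : comNzRingType) (m n : nat) (y : R)
    (u : 'M[R]_(m, n)) (v : 'M[R]_(n, m)) :
  y ^+ n * \det (y%:M - u *m v) = y ^+ m * \det (y%:M - v *m u).
Proof.
pose M := block_mx y%:M u v 1%:M.
have detM : \det M = \det (y%:M - u *m v).
  have <- : \det (M *m block_mx 1%:M 0 (- v) 1%:M) = \det M.
    by rewrite det_mulmx det_lblock !det1 !mulr1.
  rewrite mulmx_block !mulmx1 !mul1mx !mulmx0 mulmxN subrr !add0r.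
  by rewrite det_ublock det1 mulr1.
rewrite -detM.
have -> : y ^+ n * \det M = \det (block_mx 1%:M 0 (- v) y%:M *m M).
  by rewrite det_mulmx det_lblock det1 mul1r det_scalar.
rewrite mulmx_block !mul1mx !mul0mx !addr0 mulmx1 mulNmx mul_mx_scalar.
by rewrite mul_scalar_mx addNr det_ublock det_scalar mulNmx addrC.
Qed.

(** A constant matrix is a column times a row, so swapping the factors leaves a determinant of size
    1. *)
Lemma det_scalar_sub_const (R : comNzRingType) (k : nat) (y a : R) :
  y * \det (y%:M - const_mx a : 'M_k) = y ^+ k * (y - a *+ k).
Proof.
have -> : const_mx a = (const_mx a : 'cV[R]_k) *m (const_mx 1 : 'rV[R]_k).
  by apply/matrixP=> i j; rewrite !mxE big_ord1 !mxE mulr1.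
rewrite -{1}[y]expr1 det_scalar_sub_mulmxC [X in _ * \det X]mx11_scalar.
rewrite det_scalar1 !mxE eqxx mulr1n; congr (_ * (_ - _)).
rewrite (eq_bigr (fun=> a)) => [|i _]; last by rewrite !mxE mul1r.
by rewrite sumr_const card_ord.
Qed.

(** * Complete multipartite graphs, where [None] marks the isolated vertices *)

Section Multipartite.
Variables (F : fieldType) (T K : finType) (f : T -> option K) (a : nat).
Variable adj : rel T.
Hypothesis card_part : forall k, #|[set x | f x == Some k]| = a.
Hypothesis adjE : forall x y,
  adj x y = [&& f x != None, f y != None & f x != f y].

Let B : 'M[F]_(#|T|, #|K|) :=
  \matrix_(i, k) (f (enum_val i) == Some (enum_val k))%:R.

Let trB_mulB : B^T *m B = a%:R%:M.
Proof.
apply/matrixP=> k l; rewrite !mxE.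
under eq_bigr do rewrite !mxE -natrM mulnb.
rewrite -natr_sum -(big_enum_val (A := T)
  (fun x => nat_of_bool ((f x == Some (enum_val k)) && (f x == Some (enum_val l))))).
have [<-|neq_kl] := eqVneq k l.
  rewrite mulr1n -(card_part (enum_val k)) -sum1dep_card big_mkcond /=; congr _%:R.
  rewrite [RHS]big_mkcond.
  by apply: eq_bigr => x _; rewrite andbb; case: eqP.
rewrite mulr0n big1 // => x _; case: eqP => //= ->.
by rewrite (inj_eq Some_inj) (inj_eq enum_val_inj) (negPf neq_kl).
Qed.

Let adjacency_factor :
  adjacency_mx F adj = B *m (const_mx 1 - 1%:M) *m B^T.
Proof.
apply/matrixP=> i j; rewrite mulmxBr mulmx1 mulmxBl !mxE adjE.
set x := enum_val i; set y := enum_val j.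
(* A row of [B] has a single 1, at the part of its vertex, or is zero if the vertex is isolated;
   summing against it evaluates [G] at that part. *)
have sumf (z : T) (G : K -> F) : \sum_(k < #|K|)
    (f z == Some (enum_val k))%:R * G (enum_val k) = oapp G 0 (f z).
  rewrite -(big_enum_val (A := K)
    (fun k => (f z == Some k)%:R * G k)) /=.
  case: (f z) => [k|] /=.
    rewrite (bigD1 k) //= eqxx mul1r big1 ?addr0 // => l neq_lk.
    by rewrite (inj_eq Some_inj) eq_sym (negPf neq_lk) mul0r.
  by rewrite big1 // => k _; rewrite mul0r.
rewrite (eq_bigr (fun l => (f y == Some (enum_val l))%:R
                           * (f x != None)%:R)); last first.
  move=> l _; rewrite !mxE mulrC; congr (_ * _).
  rewrite (eq_bigr (fun k => (f x == Some (enum_val k))%:R * 1)); last first.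
    by move=> k _; rewrite !mxE.
  by rewrite (sumf x (fun=> 1)); case: (f x).
rewrite (sumf y (fun=> (f x != None)%:R)).
rewrite (eq_bigr (fun k => (f x == Some (enum_val k))%:R
                           * (f y == Some (enum_val k))%:R)); last first.
  by move=> k _; rewrite !mxE.
rewrite (sumf x (fun k => (f y == Some k)%:R)).
case: (f x) (f y) => [k|] [l|] //=; rewrite ?subr0 // ?(inj_eq Some_inj) eq_sym.
by case: eqP; rewrite ?subrr ?subr0.
Qed.

(* The factors X^#|K| and X + a on the left avoid the exponents #|T| - #|K| and
   #|K| - 1, which would be truncated for small #|T| and #|K|. *)
Lemma char_poly_multipartite :
  'X^#|K| * ('X + a%:R) * char_poly (adjacency_mx F adj) =
  'X^#|T| * ('X + a%:R) ^+ #|K| * ('X - (#|K|%:R - 1) * a%:R) :> {poly F}.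
Proof.
rewrite /char_poly /char_poly_mx adjacency_factor -mulmxA map_mxM mulrAC.
rewrite det_scalar_sub_mulmxC -map_mxM -mulmxA trB_mulB -!mulrA [_ * ('X + _)]mulrC.
congr (_ * _).
(* Since X - a (J - 1) = (X + a) - a J, the constant-matrix formula applies with y = X + a, which is
   where the extra factor X + a comes from. *)
have -> : 'X%:M - map_mx polyC ((const_mx 1 - 1%:M) *m a%:R%:M)
    = ('X + a%:R)%:M - const_mx a%:R :> 'M[{poly F}]_#|K|.
  apply/matrixP=> i j; rewrite mul_mx_scalar !mxE !rmorphM rmorphB /= polyC1.
  by rewrite !rmorph_nat mulrBr mulr1 mulr_natr mulrnDl opprB addrA addrAC.
rewrite [LHS]mulrC [RHS]mulrC det_scalar_sub_const; congr (_ * _).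
by rewrite -[a%:R *+ _]mulr_natl mulrBl mul1r opprB addrA addrAC.
Qed.

(** Orders at [c] add up over the factors of [char_poly_multipartite]. The indicators stay separate
    because the roots may coincide in [F]. *)
Lemma mup_multipartite (c : F) :
  ((if 0%R == c then #|K| else 0) + (- a%:R == c)%R
     + mup c (char_poly (adjacency_mx F adj)))%N =
  ((if 0%R == c then #|T| else 0) + (if (- a%:R == c)%R then #|K| else 0)
     + ((#|K|%:R - 1) * a%:R == c)%R)%N.
Proof.
have XE : 'X = 'X - 0%:P :> {poly F} by rewrite subr0.
have XaE : 'X + a%:R = 'X - (- a%:R)%:P :> {poly F}.
  by rewrite polyCN opprK polyC_natr.
have XkE : 'X - (#|K|%:R - 1) * a%:R = 'X - ((#|K|%:R - 1) * a%:R)%:P :> {poly F}.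
  by rewrite polyCM polyCB !polyC_natr.
have nz n (b : F) : ('X - b%:P) ^+ n != 0 by rewrite expf_neq0 ?polyXsubC_eq0.
have nz1 (b : F) : 'X - b%:P != 0 := nz 1%N b.
have mup1 (b : F) : mup c ('X - b%:P) = (b == c).
  by rewrite -[_ - _]expr1 mup_XsubCX; case: eqP.
have := congr1 (mup c) char_poly_multipartite.
rewrite XkE XaE [X in X ^+ _]XE [X in _ = mup _ (X ^+ _ * _ * _)]XE.
have nzA := monic_neq0 (char_poly_monic (adjacency_mx F adj)).
by rewrite !mupM ?mulf_neq0 // !mup_XsubCX !mup1.
Qed.

End Multipartite.

(** * Linear independence and the projective line *)

Definition cross (F : fieldType) (v w : F * F) : F := v.1 * w.2 - v.2 * w.1.

(* The point of the projective line over F represented by v, with [Some None]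
   the point at infinity; the zero vector has none. *)
Definition slope (F : fieldType) (v : F * F) : option (option F) :=
  if v.1 != 0 then Some (Some (v.2 / v.1))
  else if v.2 != 0 then Some None else None.

Lemma cross_slope (F : fieldType) (v w : F * F) :
  (cross v w != 0) = [&& slope v != None, slope w != None & slope v != slope w].
Proof.
case: v w => [a b] [c d]; rewrite /cross /slope /=.
have [->|a0] := eqVneq a 0; have [->|c0] := eqVneq c 0 => /=.
- rewrite mul0r mulr0 subrr eqxx.
  by have [|] := eqVneq b 0; have [|] := eqVneq d 0.
- rewrite mul0r sub0r oppr_eq0 mulf_eq0 negb_or c0 andbT.
  by have [|] := eqVneq b 0.
- rewrite mulr0 subr0 mulf_eq0 negb_or a0.
  by have [|] := eqVneq d 0.
rewrite subr_eq0 !(inj_eq Some_inj) eqr_div // eq_sym.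
by rewrite [d * a]mulrC.
Qed.

(** The scalars parametrize a line injectively through [g]; only the zero vector has to be left
    out. *)
Lemma card_slope (F : finFieldType) (k : option F) :
  #|[set v | slope v == Some k]| = #|F|.-1.
Proof.
pose g (c : F) : F * F := if k is Some s then (c, s * c) else (0, c).
have g_inj : injective g.
  by rewrite /g => c d; case: (k) => [s|] [].
have <- : #|[set~ (0 : F)]| = #|F|.-1 by rewrite cardsC1.
rewrite -(card_imset _ g_inj); congr #|pred_of_set _|; apply/setP=> -[a b].
rewrite inE /slope /=; apply/eqP/imsetP => [|[c]].
  have [->|a0] /= := eqVneq a 0.
    by have [//|b0] := eqVneq b 0 => -[kE]; exists b; rewrite ?inE // /g -kE.
  by move=> [kE]; exists a; rewrite ?inE // /g -kE divfK.
rewrite !inE /g => c0; case: (k) => [s|] [-> ->].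
  by rewrite c0 mulfK.
by rewrite eqxx c0.
Qed.

(** * Residues modulo prime powers and their reduction modulo p *)

Lemma expg_pair (gT1 gT2 : finGroupType) (x : gT1 * gT2) (n : nat) :
  (x ^+ n = (x.1 ^+ n, x.2 ^+ n))%g.
Proof. by elim: n => [|n IH] //; rewrite !expgS IH. Qed.

Lemma Zp_mulE (q : nat) (x y : 'Z_q) : x * y = x *+ (y : nat).
Proof. by rewrite -[y in LHS]natr_Zp mulr_natr. Qed.

Section Reduction.
Variables (p e : nat).
Hypotheses (p_prime : prime p) (e_gt0 : (0 < e)%N).

Definition reduce (x : 'Z_(p ^ e)) : 'F_p := (x : nat)%:R.

Let q_gt1 : (1 < p ^ e)%N.
Proof. by rewrite -(exp1n e) ltn_exp2r // prime_gt1. Qed.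

Let p_dvd_q : (p %| p ^ e)%N.
Proof. by rewrite dvdn_exp. Qed.

Lemma reduce_nat (n : nat) : reduce n%:R = n%:R.
Proof.
rewrite /reduce val_Zp_nat // -[in RHS](Fp_nat_mod p_prime) -(modn_dvdm n p_dvd_q).
by rewrite (Fp_nat_mod p_prime).
Qed.

Lemma reduceD (x y : 'Z_(p ^ e)) : reduce (x + y) = reduce x + reduce y.
Proof. by rewrite -(natr_Zp x) -(natr_Zp y) -natrD !reduce_nat natrD. Qed.

Lemma reduceM (x y : 'Z_(p ^ e)) : reduce (x * y) = reduce x * reduce y.
Proof. by rewrite -(natr_Zp x) -(natr_Zp y) -natrM !reduce_nat natrM. Qed.

Lemma reduceB (x y : 'Z_(p ^ e)) : reduce (x - y) = reduce x - reduce y.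
Proof. by apply: (addIr (reduce y)); rewrite -reduceD !subrK. Qed.

Lemma reduce_unit (x : 'Z_(p ^ e)) : (x \is a GRing.unit) = (reduce x != 0).
Proof.
rewrite -unitfE -{1}(natr_Zp x) unitZpE // /reduce unitFpE //.
by rewrite coprime_pexpl.
Qed.

(** The p fibers are translates of the kernel, so they share the p ^ e residues equally. *)
Lemma card_reduce (c : 'F_p) : #|[set x | reduce x == c]| = (p ^ e.-1)%N.
Proof.
have card_fiber d : #|[set x | reduce x == d]| = #|[set x | reduce x == 0]|.
  rewrite -[in RHS](card_imset _ (addrI ((d : nat)%:R : 'Z_(p ^ e)))).
  congr #|pred_of_set _|; apply/setP=> x; apply/idP/imsetP => [|[y]]; rewrite inE.
    move/eqP=> xd; exists (x - (d : nat)%:R); last by rewrite addrC subrK.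
    rewrite inE -(inj_eq (addIr (reduce (d : nat)%:R))) -reduceD subrK add0r xd.
    by rewrite reduce_nat natr_Zp.
  by move=> /eqP y0 ->; rewrite inE reduceD y0 addr0 reduce_nat natr_Zp.
apply/eqP; rewrite card_fiber -(eqn_pmul2l (prime_gt0 p_prime)) -expnS prednK //.
have cardZ : #|'Z_(p ^ e)| = (p ^ e)%N by rewrite card_ord Zp_cast.
rewrite -[eqbRHS]cardZ -[eqbRHS]sum1_card (partition_big reduce xpredT) //=.
rewrite (eq_bigr (fun=> #|[set x | reduce x == 0]|)) => [|d _].
  by rewrite sum_nat_const card_Fp ?eqxx.
by rewrite -(card_fiber d) -sum1dep_card.
Qed.

End Reduction.

(** * Generating pairs and reduction to the plane over F_p *)

Section Plane.
Variables (p e t : nat).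
Hypotheses (p_prime : prime p) (e_gt0 : (0 < e)%N) (t_gt0 : (0 < t)%N).
Let G : finGroupType := ('Z_(p ^ e) * 'Z_(p ^ t))%type.

Definition reduce2 (x : G) : 'F_p * 'F_p := (reduce x.1, reduce x.2).

Lemma card_reduce2 (P : pred ('F_p * 'F_p)) :
  #|[set x | P (reduce2 x)]| = (#|[set v | P v]| * p ^ (e.-1 + t.-1))%N.
Proof.
rewrite -sum1dep_card (partition_big reduce2 P) //=.
rewrite -sum_nat_const; apply: congr_big => // v; first by rewrite inE.
move=> Pv; rewrite expnD -(card_reduce p_prime e_gt0 v.1).
rewrite -(card_reduce p_prime t_gt0 v.2) -cardsX -sum1_card.
apply: eq_bigl => x; rewrite !inE [X in _ && X]xpair_eqE.
rewrite andb_idl // => /andP[/eqP x1 /eqP x2].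
by rewrite /reduce2 x1 x2 -surjective_pairing.
Qed.

Lemma gen_full_cross (x y : G) :
  (<<[set x; y]>>%g == [set: G]) = (cross (reduce2 x) (reduce2 y) != 0).
Proof.
apply/eqP/idP => [genG|nz].
  apply/eqP=> cross0.
  (* A linear form modulo p that kills x and y kills <x, y> = G. *)
  have no_form (l m : 'F_p) : l * reduce x.1 + m * reduce x.2 = 0 ->
      l * reduce y.1 + m * reduce y.2 = 0 -> l = 0 /\ m = 0.
    move=> lx ly.
    pose H := [set z : G | l * reduce z.1 + m * reduce z.2 == 0].
    have gH : group_set H.
      apply/group_setP; split=> [|u v]; rewrite !inE.
        by rewrite /reduce /= !mulr0 addr0.
      move=> /eqP u0 /eqP v0; rewrite !reduceD // !mulrDr addrACA u0 v0.
      by rewrite addr0.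
    have HT z : z \in H.
      have : <<[set x; y]>>%g \subset Group gH.
        by rewrite gen_subG; apply/subsetP => u /set2P[]->; rewrite inE ?lx ?ly.
      by rewrite genG => /subsetP; apply; rewrite inE.
    (* The coefficients of the form are its values at (1, 0) and (0, 1). *)
    split; [have := HT (1%:R, 0%:R) | have := HT (0%:R, 1%:R)];
    by rewrite inE !reduce_nat // mulr0 mulr1 ?addr0 ?add0r => /eqP.
  (* The forms [cross x _] and [cross y _] kill both x and y, so the first coordinates of x and y
     vanish modulo p; then the first coordinate is itself a nonzero form killing both. *)
  have /no_form[] : - reduce x.2 * reduce x.1 + reduce x.1 * reduce x.2 = 0.
    by rewrite mulNr mulrC addNr.
  - by rewrite mulNr addrC.
  move=> _ x10.
  have /no_form[] : - reduce y.2 * reduce x.1 + reduce y.1 * reduce x.2 = 0.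
  - rewrite mulNr addrC -opprB mulrC [reduce y.1 * _]mulrC.
    by rewrite [_ - _]cross0 oppr0.
  - by rewrite mulNr mulrC addNr.
  move=> _ y10.
  have /no_form[] : 1 * reduce x.1 + 0 * reduce x.2 = 0 by rewrite x10 mulr0 mul0r addr0.
    by rewrite y10 mulr0 mul0r addr0.
  by move/eqP; rewrite oner_eq0.
(* Cramer: y.2 x - x.2 y = (u, 0) and x.1 y - y.1 x = (0, w). *)
pose u : 'Z_(p ^ e) := x.1 * (y.2 : nat)%:R - y.1 * (x.2 : nat)%:R.
pose w : 'Z_(p ^ t) := (x.1 : nat)%:R * y.2 - (y.1 : nat)%:R * x.2.
(* Both [u] and [w] reduce to the nonzero determinant modulo p. Natural representatives carry
   coordinates between the two moduli and serve as exponents below. *)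
have uU : u \is a GRing.unit.
  rewrite (reduce_unit p_prime e_gt0) reduceB // !reduceM // !reduce_nat //.
  by rewrite [reduce y.1 * _]mulrC.
have wU : w \is a GRing.unit.
  rewrite (reduce_unit p_prime t_gt0) reduceB // !reduceM // !reduce_nat //.
  by rewrite [_ * reduce x.2]mulrC.
have [xH yH] : x \in <<[set x; y]>>%g /\ y \in <<[set x; y]>>%g.
  by split; apply: mem_gen; rewrite !inE eqxx ?orbT.
have uH : ((u, 0) : G) \in <<[set x; y]>>%g.
  have -> : (u, 0) = (x ^+ (y.2 : nat) * (y ^+ (x.2 : nat))^-1)%g :> G.
    rewrite !expg_pair !FinRing.Theory.zmodXgE; congr (_, _); rewrite /= /u ?mulr_natr //.
    by rewrite -!Zp_mulE mulrC; apply/esym/subrr.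
  by rewrite groupM ?groupV ?groupX.
have wH : ((0, w) : G) \in <<[set x; y]>>%g.
  have -> : (0, w) = ((x ^+ (y.1 : nat))^-1 * (y ^+ (x.1 : nat)))%g.
    rewrite !expg_pair !FinRing.Theory.zmodXgE; congr (_, _); rewrite /= /w ?mulr_natl.
      by rewrite -!Zp_mulE mulrC; apply/esym/addNr.
    by rewrite addrC.
  by rewrite groupM ?groupV ?groupX.
apply/setP=> -[a b]; rewrite inE.
(* A unit generates the additive group: the multiplier is the representative of [a / u]. *)
have [n ->] : exists n : nat, a = u *+ n.
  by exists (a / u : 'Z_(p ^ e)); rewrite -Zp_mulE mulrC divrK.
have [m ->] : exists m : nat, b = w *+ m.
  by exists (b / w : 'Z_(p ^ t)); rewrite -Zp_mulE mulrC divrK.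
have -> : (u *+ n, w *+ m) = (((u, 0) : G) ^+ n * ((0, w) : G) ^+ m)%g.
  rewrite !expg_pair !FinRing.Theory.zmodXgE /= !mul0rn.
  by congr (_, _); apply/esym; [apply: addr0 | apply: add0r].
by rewrite groupM ?groupX.
Qed.

Lemma generating_graphE (x y : G) :
  generating_graph x y =
  [&& slope (reduce2 x) != None, slope (reduce2 y) != None
    & slope (reduce2 x) != slope (reduce2 y)].
Proof.
rewrite /generating_graph gen_full_cross -cross_slope andb_idl //.
by apply: contraNneq => ->; rewrite /cross mulrC subrr.
Qed.

(** Each of the p - 1 nonzero vectors on a line has p ^ (e + t - 2) lifts. *)
Lemma card_slope_fiber (k : option 'F_p) :
  #|[set x : G | slope (reduce2 x) == Some k]| = totient (p ^ (e + t - 1)).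
Proof.
rewrite (card_reduce2 (fun v => slope v == Some k)) card_slope card_Fp //.
case: e e_gt0 => // e' _; case: t t_gt0 => // t' _.
by rewrite addSn subn1 addnS totient_pfactor.
Qed.

End Plane.

(** * The spectrum of the generating graph *)

Theorem theorem6p1 (F : numFieldType) (p e t : nat)
    (p_prime : prime p) (e_ge1 : (1 <= e)%N) (t_ge1 : (1 <= t)%N) :
  let G : finGroupType := ('Z_(p ^ e) * 'Z_(p ^ t))%type in
  let A : 'M[F]_#|G| := adjacency_mx F (@generating_graph G) in
  let alpha : nat := totient (p ^ (e + t - 1)) in
  spectrum_is A
    [:: (- alpha%:R, p);
        (0, (p ^ (e + t) - (p + 1))%N);
        ((p * alpha)%:R, 1%N)].
Proof.
move=> G A alpha.
have p_gt1 := prime_gt1 p_prime.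
have card_G : #|G| = (p ^ (e + t))%N.
  have cardZ n : (0 < n)%N -> #|'Z_(p ^ n)| = (p ^ n)%N.
    by move=> n0; rewrite card_ord Zp_cast // -(exp1n n) ltn_exp2r.
  by rewrite card_prod !cardZ // expnD.
(* Strictness, from p + 1 < p ^ 2, makes the multiplicity of 0 positive, so that 0 is an
   eigenvalue. *)
have card_G_gt : (p + 1 < p ^ (e + t))%N.
  apply: (@leq_trans (p ^ 2)); last by rewrite leq_exp2l // (leq_add e_ge1 t_ge1).
  by have := leq_mul p_gt1 (leqnn p); rewrite -mulnn; lia.
have alpha_gt0 : (0 < alpha)%N by rewrite totient_gt0 expn_gt0 prime_gt0.
(* Characteristic zero keeps the three eigenvalues distinct. *)
have alpha_neq0 : alpha%:R != 0 :> F by rewrite pnatr_eq0 -lt0n.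
have alpha2_neq0 : (p * alpha)%:R != 0 :> F.
  by rewrite pnatr_eq0 muln_eq0 negb_or -!lt0n prime_gt0.
have alpha12 : - alpha%:R != (p * alpha)%:R :> F.
  by rewrite eq_sym -addr_eq0 -natrD pnatr_eq0 addn_eq0 negb_and -!lt0n alpha_gt0 orbT.
have mupA (c : F) := mup_multipartite
  (card_slope_fiber p_prime e_ge1 t_ge1) (generating_graphE p_prime e_ge1 t_ge1) c.
(* There are p + 1 parts, so the last root is (p + 1 - 1) alpha = p alpha. *)
have mupE (c : F) : ((if 0%R == c then p.+1 else 0) + (- alpha%:R == c)%R
      + mup c (char_poly A))%N =
    ((if 0%R == c then p ^ (e + t) else 0) + (if (- alpha%:R == c)%R then p.+1 else 0)
      + ((p * alpha)%:R == c)%R)%N.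
  have := mupA c; rewrite -/A; move: (mup c (char_poly A)) => m.
  rewrite card_option card_Fp // card_G natrM.
  by rewrite -[p.+1%:R]natr1 addrK.
move: (p ^ (e + t))%N card_G_gt mupE {card_G mupA} => N N_gt mupE.
have nzA := monic_neq0 (char_poly_monic A).
split.
- by rewrite /= !inE negb_or oppr_eq0 alpha_neq0 alpha12 eq_sym alpha2_neq0.
(* Eigenvalues are the points of positive order m. Here [mupE] reads p + 1 + m = N at 0, 1 + m = p +
   1 at - alpha, m = 1 at p alpha, and m = 0 elsewhere. *)
- move=> c; rewrite eigenvalue_root_char -dvdp_XsubCl XsubC_dvd // /= !inE.
  have := mupE c; move: (mup c (char_poly A)) => m.
  rewrite [c == _]eq_sym [c == 0]eq_sym [c == (_ * _)%:R]eq_sym.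
  have [<-|_] := eqVneq 0 c.
    by rewrite oppr_eq0 (negPf alpha_neq0) (negPf alpha2_neq0) /=; lia.
  have [<-|_] := eqVneq (- alpha%:R) c.
    by rewrite eq_sym (negPf alpha12) /=; have := prime_gt0 p_prime; lia.
  by case: eqP => _ /=; lia.
move=> c; rewrite !inE => /or3P[] /eqP-> /=; have := mupE.
- move/(_ (- alpha%:R)); move: (mup _ _) => m.
  rewrite eqxx [0 == _]eq_sym oppr_eq0 (negPf alpha_neq0).
  by rewrite [_%:R == _]eq_sym (negPf alpha12) /=; lia.
- move/(_ 0); move: (mup _ _) => m.
  by rewrite eqxx oppr_eq0 (negPf alpha_neq0) (negPf alpha2_neq0) /=; lia.
- move/(_ (p * alpha)%:R); move: (mup _ _) => m.
  by rewrite eqxx (negPf alpha12) [0 == _]eq_sym (negPf alpha2_neq0) /=; lia.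
Qed.
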